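(* Let $a<b$ be positive odd integers. There exist infinite smooth words over $\{a,b\}$ that are infinite Lyndon words if and only if $a=1$. Moreover, when $a=1$, the infinite smooth words over $\{1,b\}$ that are infinite Lyndon words are exactly the two words $m_{\{1<b\}}$ and $\Delta^{-1}_1(m_{\{1<b\}})$.
   Context: Words over $\{a,b\}$ are compared lexicographically with $a<b$. For a word $w$ over $\{a,b\}$ written as maximal blocks $\alpha_0^{i_0}\alpha_1^{i_1}\cdots$ ($\alpha_{k+1}\ne\alpha_k$, $i_k\ge1$), $\Delta(w)=i_0i_1\cdots$. An infinite word $w\in\{a,b\}^\omega$ is smooth if $\Delta^k(w)\in\{a,b\}^\omega$ for all $k\ge0$. $m_{\{a<b\}}$ is the lexicographically minimal infinite smooth word over $\{a,b\}$. For $\alpha\in\{a,b\}$ with complement $\overline\alpha$ (the other letter) and a word $u$ over positive integers, $\Delta^{-1}_\alpha(u)=\alpha^{u[0]}\overline\alpha^{u[1]}\alpha^{u[2]}\cdots$. An infinite Lyndon word is an infinite word strictly smaller than each of its proper suffixes. *)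

(* Defs.v *)
From mathcomp Require Import all_boot.
Set Implicit Arguments.
Unset Strict Implicit.
Unset Printing Implicit Defensive.

(* Infinite words over the natural numbers, compared with [=1]. *)
Definition word := nat -> nat.

Definition over (a b : nat) (w : word) : Prop := forall i, w i = a \/ w i = b.

Definition suffix_at (n : nat) (w : word) : word := fun i => w (n + i).

Definition lex_lt (u v : word) : Prop :=
  exists2 n, (forall i, i < n -> u i = v i) & u n < v n.

Definition lex_le (u v : word) : Prop := u =1 v \/ lex_lt u v.

Definition infinite_lyndon (w : word) : Prop :=
  forall n, 0 < n -> lex_lt w (suffix_at n w).

Definition block_start (u : word) (k : nat) : nat := \sum_(j < k) u j.

(* Block k occupies the positions from [block_start u k] to
   [block_start u k.+1 - 1]. When all [u k] are positive, only blocks k < i can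
   end before position i, so the sum counts all the blocks that do. *)
Definition block_index (u : word) (i : nat) : nat :=
  \sum_(k < i) (block_start u k.+1 <= i).

(* alpha_0^{u_0} alpha_1^{u_1} alpha_2^{u_2} ... (for positive exponents). *)
Definition blocks (alpha u : word) : word := fun i => alpha (block_index u i).

(* [Delta w u] is "Delta(w) is defined as an infinite word and equals u".
   Delta is relational because a word that is eventually constant has finitely
   many blocks, the last one infinite; [Delta_unique] gives functionality. *)
Definition Delta (w u : word) : Prop :=
  (forall k, 0 < u k) /\
  exists2 alpha : word, (forall k, alpha k.+1 <> alpha k) & w =1 blocks alpha u.

Fixpoint Delta_iter (k : nat) (w u : word) : Prop :=
  if k is k'.+1 then exists2 v, Delta_iter k' w v & Delta v u else w =1 u.

Definition smooth (a b : nat) (w : word) : Prop :=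
  forall k, exists2 u, Delta_iter k w u & over a b u.

Definition min_smooth (a b : nat) (m : word) : Prop :=
  smooth a b m /\ forall w, smooth a b w -> lex_le m w.

Definition complement (a b alpha : nat) : nat := if alpha == a then b else a.

Definition Delta_inv (a b alpha : nat) (u : word) : word :=
  blocks (fun k => if odd k then complement a b alpha else alpha) u.

Lemma block_startS u k : block_start u k.+1 = block_start u k + u k.
Proof. by rewrite /block_start big_ord_recr. Qed.

Lemma block_start_mono u : {homo block_start u : k l / k <= l}.
Proof.
move=> k l /subnK <-; elim: (l - k) => [|d IH] //.
by rewrite addSn block_startS (leq_trans IH) // leq_addr.
Qed.

Lemma leq_block_start u k : (forall k, 0 < u k) -> k <= block_start u k.
Proof.
move=> u0; elim: k => [|k IH] //.
by rewrite block_startS -addn1 leq_add.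
Qed.

Lemma blocksE (alpha u : word) k j : (forall k, 0 < u k) -> j < u k ->
  blocks alpha u (block_start u k + j) = alpha k.
Proof.
move=> u0 jk; rewrite /blocks; congr alpha; rewrite /block_index.
set n := block_start u k + j.
have kn : k <= n by rewrite (leq_trans (leq_block_start k u0)) ?leq_addr.
rewrite -(big_mkord xpredT (fun l => (block_start u l.+1 <= n) : nat)).
rewrite (big_cat_nat (leq0n k) kn) /=.
rewrite [X in _ + X]big_nat_cond [X in _ + X]big1.
  rewrite big_nat_cond (eq_bigr (fun=> 1)).
    by rewrite -big_nat_cond sum_nat_const_nat subn0 muln1 addn0.
  move=> l /andP[/andP[_ lk] _].
  by rewrite (leq_trans (block_start_mono u lk)) ?leq_addr.
move=> l /andP[/andP[kl _] _].
apply/eqP; rewrite eqb0 -ltnNge.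
rewrite (@leq_trans (block_start u k.+1)) //; last exact: block_start_mono.
by rewrite block_startS ltn_add2l.
Qed.

Lemma Delta_unique w u v : Delta w u -> Delta w v -> u =1 v.
Proof.
have wlt (u' v' al be : word) k : (forall k, 0 < u' k) -> (forall k, 0 < v' k) ->
    (forall k, al k.+1 <> al k) -> blocks al u' =1 blocks be v' ->
    block_start u' k = block_start v' k -> u' k < v' k -> False.
  move=> u0 v0 aln E S lt; apply: (aln k).
  have := E (block_start u' k); rewrite -[block_start u' k in LHS]addn0 blocksE //.
  rewrite S -[block_start v' k]addn0 blocksE // => ->.
  have := E (block_start u' k.+1).
  rewrite -[block_start u' k.+1 in LHS]addn0 blocksE // => ->.
  by rewrite block_startS S blocksE.
move=> [u0 [al aln Eu]] [v0 [be ben Ev]] k.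
have E : blocks al u =1 blocks be v by move=> i; rewrite -Eu -Ev.
elim/ltn_ind: k => k IH.
have S : block_start u k = block_start v k.
  by apply: eq_bigr => j _; apply: IH.
case: (ltngtP (u k) (v k)) => // lt; first by case: (wlt u v al be k).
by case: (wlt v u be al k) => // i; rewrite E.
Qed.

Lemma Delta_invK a b alpha u : a <> b -> alpha = a \/ alpha = b ->
  (forall k, 0 < u k) -> Delta (Delta_inv a b alpha u) u.
Proof.
move=> ab al u0; split=> //.
exists (fun k => if odd k then complement a b alpha else alpha) => // k.
rewrite /= /complement; move/eqP: ab.
by case: al => ->; case: (odd k) => /=; rewrite ?eqxx; case: eqVneq => // *; apply/eqP; rewrite // eq_sym.
Qed.

(* Main.v *)
(* Write c^{u_0} d^{u_1} c^{u_2} ... for [runs c d u]. Since a < b, comparing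
   [runs a b u] and [runs a b v] lexicographically amounts to comparing u and v
   in the alternating order (larger is better at even indices, smaller at odd
   ones); since all letters are odd, comparing [runs b a u] and [runs b a v] in
   the alternating order amounts to comparing u and v lexicographically.
   Hence [runs a b u] is Lyndon iff u is alternatingly smaller than its suffixes
   at even positions, and this descends along Delta. If u starts with b, then
   a = 1 and u = [runs b 1 v] with v again a Lyndon word starting with 1^b, so
   that iterating determines the word as the fixed point m of
   [runs 1 b (runs b 1 _)]; the same monotonicity makes m minimal. If u starts
   with a, then u has only letters a at even indices, which again forces a = 1,
   and u is itself a Lyndon word of the first kind, i.e. m. *)
From mathcomp Require Import all_boot.
Require Import Defs.
From Stdlib Require Import Classical FunctionalExtensionality.

Set Implicit Arguments.
Unset Strict Implicit.
Unset Printing Implicit Defensive.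

(** * Words and the two orders on them *)

Definition agree (n : nat) (u v : word) : Prop := forall i, i < n -> u i = v i.

Definition positive (u : word) : Prop := forall k, 0 < u k.

Definition all_odd (u : word) : Prop := forall k, odd (u k).

Definition alternate (c d : nat) : word := fun k => if odd k then d else c.

Definition runs (c d : nat) (u : word) : word := blocks (alternate c d) u.

Definition cons_word (x : nat) (u : word) : word :=
  fun i => if i is i'.+1 then u i' else x.

Definition alt_lt (u v : word) : Prop :=
  exists2 n, agree n u v & if odd n then u n < v n else v n < u n.

(** Only even positions matter: a suffix of [runs a b u] starting at a block of a corresponds to a
    suffix of u at an even position, and one starting with b > a is larger at its first letter. *)
Definition alt_lyndon (u : word) : Prop :=
  forall j, 0 < j -> alt_lt u (suffix_at j.*2 u).

Definition even_lyndon (u : word) : Prop :=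
  forall j, 0 < j -> lex_lt u (suffix_at j.*2 u).

Lemma odd_positive u : all_odd u -> positive u.
Proof. by move=> uo k; rewrite odd_gt0. Qed.

Lemma positive_cons x u : 0 < x -> positive u -> positive (cons_word x u).
Proof. by move=> x0 u0 [|k] /=. Qed.

Lemma all_odd_cons x u : odd x -> all_odd u -> all_odd (cons_word x u).
Proof. by move=> ox uo [|k] /=. Qed.

Lemma all_odd_suffix n u : all_odd u -> all_odd (suffix_at n u).
Proof. by move=> uo k; apply: uo. Qed.

Lemma over_all_odd a b u : odd a -> odd b -> over a b u -> all_odd u.
Proof. by move=> oa ob ou k; case: (ou k) => ->. Qed.

(** Equality of infinite words is not decidable, hence the classical case split; stating it as [=]
    lets later proofs rewrite with it. *)
Lemma first_difference u v : u = v \/ exists2 n, agree n u v & u n <> v n.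
Proof.
case: (classic (exists n, u n != v n)) => [ex|nex]; last first.
  left; apply: functional_extensionality => n.
  by apply/eqP; apply: contra_notT nex => ne; exists n.
right; exists (ex_minn ex); case: ex_minnP => n /eqP // ne min i lt_in.
by apply/eqP; apply: contraTT lt_in => /min; rewrite -leqNgt.
Qed.

Lemma lex_lt_total u v : [\/ u = v, lex_lt u v | lex_lt v u].
Proof.
case: (first_difference u v) => [->|[n agr ne]]; first by constructor 1.
case: (ltngtP (u n) (v n)) => // lt; first by constructor 2; exists n.
by constructor 3; exists n => // i /agr.
Qed.

Lemma alt_lt_total u v : [\/ u = v, alt_lt u v | alt_lt v u].
Proof.
case: (first_difference u v) => [->|[n agr ne]]; first by constructor 1.
have agr' : agree n v u by move=> i /agr.
by case: (ltngtP (u n) (v n)) => // lt; case E: (odd n);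
  [constructor 2 | constructor 3 | constructor 3 | constructor 2];
  exists n => //; rewrite E.
Qed.

Lemma lex_lt_asym u v : lex_lt u v -> lex_lt v u -> False.
Proof.
move=> [n agr lt] [m agr' lt'].
case: (ltngtP n m) => [lt_nm|lt_mn|eq_nm].
- by move: lt; rewrite (agr' _ lt_nm) ltnn.
- by move: lt'; rewrite (agr _ lt_mn) ltnn.
- by move: lt'; rewrite -eq_nm ltnNge (ltnW lt).
Qed.

Lemma alt_lt_asym u v : alt_lt u v -> alt_lt v u -> False.
Proof.
move=> [n agr lt] [m agr' lt'].
case: (ltngtP n m) => [lt_nm|lt_mn|eq_nm].
- by move: lt; rewrite (agr' _ lt_nm) ltnn if_same.
- by move: lt'; rewrite (agr _ lt_mn) ltnn if_same.
- by move: lt lt'; rewrite -eq_nm; case: (odd n) => /ltnW; rewrite leqNgt => /negP.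
Qed.

Lemma lex_lt_irr u : ~ lex_lt u u.
Proof. by move=> lt; apply: lex_lt_asym (lt) lt. Qed.

Lemma alt_lt_irr u : ~ alt_lt u u.
Proof. by move=> lt; apply: alt_lt_asym (lt) lt. Qed.

Lemma lex_lt_head u v : lex_lt u v -> u 0 <= v 0.
Proof. by move=> [[/= _ /ltnW|n agr _]] //; rewrite agr. Qed.

Lemma alt_lt_head u v : alt_lt u v -> v 0 <= u 0.
Proof. by move=> [[/= _ /ltnW|n agr _]] //; rewrite agr. Qed.

(** * Block positions, prefixes and suffixes of decoded words *)

Lemma block_start0 u : block_start u 0 = 0.
Proof. by rewrite /block_start big_ord0. Qed.

Lemma block_decomposition u i :
  positive u -> exists k, exists2 j, j < u k & i = block_start u k + j.
Proof.
move=> u0; elim: i => [|i [k [j lt ->]]].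
  by exists 0, 0 => //; rewrite block_start0.
case: (ltngtP j.+1 (u k)) lt => // [lt _|eq _].
  by exists k, j.+1; rewrite ?addnS.
by exists k.+1, 0; rewrite // block_startS -eq addn0 addnS.
Qed.

Lemma block_start_agree n u v :
  agree n u v -> forall k, k <= n -> block_start u k = block_start v k.
Proof. by move=> agr k kn; apply: eq_bigr => j _; apply/agr/(leq_trans _ kn). Qed.

Lemma odd_block_start u k : all_odd u -> odd (block_start u k) = odd k.
Proof.
move=> uo; elim: k => [|k IH]; first by rewrite block_start0.
by rewrite block_startS oddD IH uo addbT.
Qed.

(** Only blocks of index below i can end by position i, so letter i depends on the first i lengths
    alone. The index gained makes decoding a contraction, the source of both uniqueness and
    existence of the fixed point. *)
Lemma blocks_agree al n u v :
  agree n u v -> agree n.+1 (blocks al u) (blocks al v).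
Proof.
move=> agr i lt_in; congr (al _); apply: eq_bigr => k _.
by rewrite (block_start_agree agr) // (leq_trans (ltn_ord k)).
Qed.

Lemma blocks_start al u k : positive u -> blocks al u (block_start u k) = al k.
Proof. by move=> u0; rewrite -[block_start u k]addn0 blocksE. Qed.

Lemma blocks_head al u : positive u -> blocks al u 0 = al 0.
Proof. by move=> u0; rewrite -(blocks_start al 0 u0) block_start0. Qed.

Lemma blocks_first al u j : positive u -> j < u 0 -> blocks al u j = al 0.
Proof.
by move=> u0 lt; rewrite -(blocksE al u0 lt) block_start0.
Qed.

(** The first possible difference is where block n of u has just ended while the longer block n of v
    still continues. *)
Lemma blocks_difference al u v n : positive u -> positive v ->
  agree n u v -> u n < v n ->
  [/\ agree (block_start u n.+1) (blocks al u) (blocks al v),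
      blocks al u (block_start u n.+1) = al n.+1 &
      blocks al v (block_start u n.+1) = al n].
Proof.
move=> u0 v0 agr lt; split; last 2 first.
- exact: blocks_start.
- by rewrite block_startS (block_start_agree agr) ?blocksE.
move=> i; have [k [j lt_j ->]] := block_decomposition i u0.
move=> lt_i; have le_kn : k <= n.
  rewrite -ltnS; apply: contraLR lt_i; rewrite -leqNgt => /block_start_mono le.
  by rewrite -leqNgt (leq_trans (le u)) ?leq_addr.
rewrite blocksE // (block_start_agree agr) // blocksE //.
by move: le_kn lt_j; rewrite leq_eqVlt => /predU1P[-> /ltn_trans->//|/agr->].
Qed.

Lemma suffix_blocks al u n j : positive u -> j < u n ->
  suffix_at (block_start u n + j) (blocks al u)
  = blocks (suffix_at n al) (cons_word (u n - j) (suffix_at n.+1 u)).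
Proof.
move=> u0 lt; set v := cons_word _ _; apply: functional_extensionality => i.
have v0 : positive v by apply: positive_cons; rewrite ?subn_gt0 // => k; apply: u0.
(* From the truncated first block on, the block ends of v are those of u. *)
have Sv k : block_start u n + j + block_start v k.+1 = block_start u (n + k).+1.
  elim: k => [|k IH].
    by rewrite addn0 !block_startS block_start0 add0n /= -addnA subnKC // ltnW.
  by rewrite block_startS addnA IH addnS [RHS]block_startS /= /suffix_at addSn.
rewrite /suffix_at; have [[|k] [l lt_l ->]] := block_decomposition i v0.
  rewrite block_start0 add0n -addnA blocksE -?ltn_subRL //.
  by rewrite (blocks_first _ v0 lt_l) /suffix_at addn0.
by rewrite blocksE // addnA Sv -addnS blocksE //; move: lt_l; rewrite /= /suffix_at addSn addnS.
Qed.

Lemma suffix_blocks0 al u n : positive u ->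
  suffix_at (block_start u n) (blocks al u) = blocks (suffix_at n al) (suffix_at n u).
Proof.
move=> u0; rewrite -[block_start u n]addn0 suffix_blocks // subn0.
congr blocks; apply: functional_extensionality => -[|i] /=.
  by rewrite /suffix_at addn0.
by rewrite /suffix_at addSn addnS.
Qed.

Lemma suffix_alternate c d n :
  suffix_at n (alternate c d) = if odd n then alternate d c else alternate c d.
Proof.
apply: functional_extensionality => i; rewrite /suffix_at /alternate oddD.
by case: (odd n) => //=; rewrite if_neg.
Qed.

Lemma suffix_runs c d u n j : positive u -> j < u n ->
  suffix_at (block_start u n + j) (runs c d u)
  = (if odd n then runs d c else runs c d)
      (cons_word (u n - j) (suffix_at n.+1 u)).
Proof.
by move=> u0 lt; rewrite suffix_blocks // suffix_alternate /runs; case: (odd n).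
Qed.

Lemma suffix_runs0 c d u n : positive u ->
  suffix_at (block_start u n) (runs c d u)
  = (if odd n then runs d c else runs c d) (suffix_at n u).
Proof.
by move=> u0; rewrite suffix_blocks0 // suffix_alternate /runs; case: (odd n).
Qed.

Lemma cons_runs c d u : positive u ->
  cons_word c (runs d c u) = runs c d (cons_word 1 u).
Proof.
move=> u0; have u1 : positive (cons_word 1 u) by apply: positive_cons.
apply: functional_extensionality => -[|i] /=; first by rewrite /runs blocks_head.
have := suffix_runs0 c d 1 u1; rewrite /block_start big_ord1 /=.
by move=> /(congr1 (fun w => w i)) /= <-.
Qed.

(** * Transfer of the orders and of the Lyndon property through runs *)

Lemma runs_alt_lt a b u v : a < b -> positive u -> positive v ->
  alt_lt u v -> lex_lt (runs a b u) (runs a b v).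
Proof.
move=> ab u0 v0 [n agr lt].
case E: (odd n) lt => lt.
  have [agr' eu ev] := blocks_difference (alternate a b) u0 v0 agr lt.
  by exists (block_start u n.+1); rewrite // /runs eu ev /alternate /= E.
have agrC : agree n v u by move=> i /agr.
have [agr' ev eu] := blocks_difference (alternate a b) v0 u0 agrC lt.
exists (block_start v n.+1) => [i /agr'//|].
by rewrite /runs eu ev /alternate /= E.
Qed.

(* Runs of odd lengths keep the parity of positions: the first difference
   moves from an index n to an index of parity opposite to n. *)
Lemma runs_lex_lt a b u v : a < b -> all_odd u -> all_odd v ->
  lex_lt u v -> alt_lt (runs b a u) (runs b a v).
Proof.
move=> ab uo vo [n agr lt].
have [agr' eu ev] :=
  blocks_difference (alternate b a) (odd_positive uo) (odd_positive vo) agr lt.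
exists (block_start u n.+1) => //; rewrite odd_block_start // /runs eu ev.
by rewrite /alternate /=; case: (odd n).
Qed.

(** A strictly monotone map on a total order also reflects it. *)
Lemma runs_alt_ltE a b u v : a < b -> positive u -> positive v ->
  lex_lt (runs a b u) (runs a b v) <-> alt_lt u v.
Proof.
move=> ab u0 v0; split; last exact: runs_alt_lt.
case: (alt_lt_total u v) => [->/lex_lt_irr//|//|].
by move=> /(runs_alt_lt ab v0 u0) lt /(lex_lt_asym lt).
Qed.

Lemma runs_lex_ltE a b u v : a < b -> all_odd u -> all_odd v ->
  alt_lt (runs b a u) (runs b a v) <-> lex_lt u v.
Proof.
move=> ab uo vo; split; last exact: runs_lex_lt.
case: (lex_lt_total u v) => [->/alt_lt_irr//|//|].
by move=> /(runs_lex_lt ab vo uo) lt /(alt_lt_asym lt).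
Qed.

(** With odd lengths, a block of even index starts at an even position, where the hypothesis
    applies. *)
Lemma even_lyndon_runs a b u : a < b -> all_odd u ->
  even_lyndon (runs a b u) -> alt_lyndon u.
Proof.
move=> ab uo L j j0; have u0 := odd_positive uo.
apply/(runs_alt_ltE ab u0) => [k|]; first exact: u0.
have := suffix_runs0 a b j.*2 u0; rewrite odd_double => <-.
have /even_halfK <- : ~~ odd (block_start u j.*2).
  by rewrite odd_block_start // odd_double.
by apply: L; rewrite half_gt0 (leq_trans _ (leq_block_start _ u0)) // -[2]/(1.*2) leq_double.
Qed.

(** Three kinds of suffixes: one starting with b is larger at once; one starting at a block of a is
    governed by an even suffix of u; one starting strictly inside a block of a has a first block
    shorter than [u 0], the maximum of u over even indices. *)
Lemma alt_lyndon_runs a b u : a < b -> positive u ->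
  alt_lyndon u -> infinite_lyndon (runs a b u).
Proof.
move=> ab u0 L n; have [k [j lt ->]] := block_decomposition n u0.
case E: (odd k).
  move=> _; exists 0 => //.
  by rewrite /suffix_at addn0 /runs blocksE // blocks_head // /alternate E.
have max0 : u k <= u 0.
  have [->//|k0] := posnP k.
  rewrite -[k]addn0 -[k](even_halfK (negbT E)).
  by apply: (alt_lt_head (L _ _)); rewrite half_gt0; case: k k0 E {lt} => [|[]].
case: j lt => [|j] lt pos.
  have k0 : 0 < k.
    by case: k pos {lt E max0}; rewrite // block_start0.
  rewrite addn0 suffix_runs0 // E; apply/runs_alt_lt => // [i|]; first exact: u0.
  rewrite -[k](even_halfK (negbT E)).
  by apply: L; rewrite half_gt0; case: k k0 E {lt max0 pos} => [|[]].
rewrite suffix_runs // E; apply/runs_alt_lt => //.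
  by apply: positive_cons; rewrite ?subn_gt0 // => i; apply: u0.
by exists 0; rewrite //= (leq_trans _ max0) // ltn_subrL u0.
Qed.

Lemma lyndon_even w : infinite_lyndon w -> even_lyndon w.
Proof. by move=> L j j0; apply: L; rewrite double_gt0. Qed.

(** * Smooth words and their derivatives *)

Lemma Delta_iter_tail k w u x :
  Delta w u -> Delta_iter k.+1 w x -> Delta_iter k u x.
Proof.
move=> wu; elim: k x => [|k IH] x [v Dv vx].
  (* Functionality of [Delta] identifies the two derivatives of w. *)
  by move: Dv => /= /functional_extensionality e; subst v; apply: Delta_unique vx.
by exists v => //; apply: IH.
Qed.

Lemma smooth_over a b w : smooth a b w -> over a b w.
Proof. by move=> /(_ 0) [u /= /functional_extensionality ->]. Qed.

Lemma smooth_Delta a b w :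
  smooth a b w -> exists2 u, smooth a b u & Delta w u.
Proof.
move=> sw; have [u [v /= /functional_extensionality e vu] ou] := sw 1.
subst v; exists u => // k.
by have [x /(Delta_iter_tail vu) Dx ox] := sw k.+1; exists x.
Qed.

(** Coinduction principle; a finite set of words closed under [Delta] will serve as the invariant
    P. *)
Lemma smooth_coind a b (P : word -> Prop) :
    (forall w, P w -> over a b w /\ exists2 u, P u & Delta w u) ->
  forall w, P w -> smooth a b w.
Proof.
move=> step w Pw k; suff [u Du /step[ou _]] : exists2 u, Delta_iter k w u & P u.
  by exists u.
elim: k => [|k [v Dv /step[_ [u Pu vu]]]]; first by exists w.
by exists u => //; exists v.
Qed.

Lemma alternate_over (c d : nat) al :
    (forall k, al k = c \/ al k = d) -> (forall k, al k.+1 <> al k) ->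
  al 0 = c -> al = alternate c d.
Proof.
move=> ov ne al0; apply: functional_extensionality.
suff H : forall k, al k = alternate c d k by [].
elim=> [|k IH] //; have := ne k; rewrite IH /alternate /=.
by case: (ov k.+1) => ->; case: (odd k).
Qed.

Lemma smooth_runs a b w : 0 < a -> 0 < b -> smooth a b w ->
  exists2 u, smooth a b u &
    w 0 = a /\ w = runs a b u \/ w 0 = b /\ w = runs b a u.
Proof.
move=> a0 b0 sw; have ow := smooth_over sw.
have [u su [u0 [al ne /functional_extensionality E]]] := smooth_Delta sw.
(* Every block letter occurs in w, so it is a or b, and distinct neighbours force alternation. *)
have aw k : al k = w (block_start u k) by rewrite E blocks_start.
have ov k : al k = a \/ al k = b by rewrite aw.
exists u => //; have w0 : w 0 = al 0 by rewrite E blocks_head.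
case: (ov 0) => al0; rewrite w0 al0; [left | right]; split=> //.
  by rewrite E /runs -(alternate_over ov ne al0).
have ov' k : al k = b \/ al k = a by case: (ov k); auto.
by rewrite E /runs -(alternate_over ov' ne al0).
Qed.
Lemma runs_over a b u : over a b (runs a b u).
Proof. by move=> i; rewrite /runs /blocks /alternate; case: odd; [right|left]. Qed.

Lemma overC a b u : over a b u -> over b a u.
Proof. by move=> ou i; case: (ou i); [right | left]. Qed.

Lemma runs_even c d u n j : positive u -> j < u n -> ~~ odd n ->
  runs c d u (block_start u n + j) = c.
Proof. by move=> u0 lt /negbTE E; rewrite /runs blocksE // /alternate E. Qed.

Lemma runs_odd c d u n j : positive u -> j < u n -> odd n ->
  runs c d u (block_start u n + j) = d.
Proof. by move=> u0 lt E; rewrite /runs blocksE // /alternate E. Qed.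

Lemma runs_second c d u : positive u -> runs c d u (u 0) = d.
Proof.
move=> u0; have := @runs_odd c d u 1 0 u0 (u0 1) isT.
by rewrite /block_start big_ord1 addn0.
Qed.

Lemma block_decomposition_le u i : positive u ->
  exists k, exists2 j, j < u k & i = block_start u k + j /\ k <= i.
Proof.
move=> u0; have [k [j lt ->]] := block_decomposition i u0; exists k, j => //.
by split=> //; apply: leq_trans (leq_block_start k u0) (leq_addr _ _).
Qed.

Lemma Delta_not_eventually_constant w x n c :
  Delta w x -> ~ forall i, n <= i -> w i = c.
Proof.
move=> [x0 [al ne E]] cst; apply: (ne n).
rewrite -!(blocks_start al _ x0) -!E !cst //.
  exact: leq_block_start.
exact: leq_trans (leqnSn n) (leq_block_start _ x0).
Qed.

Lemma runs_unit_blocks c d s n : positive s ->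
    (forall i, n <= i -> runs c d s i <> runs c d s i.+1) ->
  forall l, n <= l -> s l = 1.
Proof.
move=> s0 ne l nl; apply/eqP; rewrite eqn_leq s0 andbT leqNgt.
apply/negP => lt; apply: (ne (block_start s l)).
  exact: leq_trans nl (leq_block_start l s0).
by rewrite -[X in X.+1]addn0 -addnS /runs blocks_start // blocksE.
Qed.

(** * Descent of the Lyndon property along derivatives *)

Lemma alt_lyndon_even_max u k : alt_lyndon u -> ~~ odd k -> u k <= u 0.
Proof.
move=> L; case: k => // k E; have := @alt_lt_head _ _ (L k.+1./2 _).
rewrite /suffix_at addn0 even_halfK //; apply; rewrite half_gt0.
by case: k E.
Qed.

Lemma alt_lyndon_runs_head a b v :
    a < b -> odd a -> odd b -> over a b v -> alt_lyndon (runs b a v) ->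
  [/\ a = 1, v 0 = 1 & even_lyndon v].
Proof.
move=> ab oa ob ov L; have vo := over_all_odd oa ob ov.
have v0 := odd_positive vo.
have a0 : 0 < a by rewrite odd_gt0.
(* If [v 0] exceeded 2, dropping two letters b would shorten the first block by 2, keep it odd, and
   give a lexicographically smaller v, against L. *)
have le2 : v 0 <= 2.
  rewrite leqNgt; apply/negP => lt; have := L 1 isT.
  have := suffix_runs b a v0 lt; rewrite block_start0 /= add0n => ->.
  have co : all_odd (cons_word (v 0 - 2) (suffix_at 1 v)).
    by apply: all_odd_cons; [rewrite oddB ?vo // ltnW | apply: all_odd_suffix].
  by move=> /(runs_lex_ltE ab vo co) /lex_lt_head /=; rewrite leqNgt ltn_subrL v0.
have v01 : v 0 = 1 by have := vo 0; case: (v 0) le2 => [|[|[]]].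
have b3 : 2 < b by case: b ob ab {ov L} => [|[|[|]]] //; case: a a0 {oa}.
split=> //.
  by case: (ov 0) => [<- //|vb]; rewrite -vb v01 in b3.
move=> j j0; apply/(runs_lex_ltE ab) => //; first exact: all_odd_suffix.
have := suffix_runs0 b a j.*2 v0; rewrite odd_double => <-.
have /even_halfK <- : ~~ odd (block_start v j.*2).
  by rewrite odd_block_start // odd_double.
apply: L; rewrite half_gt0 (leq_trans _ (leq_block_start _ v0)) //.
by rewrite -[2]/(1.*2) leq_double.
Qed.

(** Let v = [runs 1 b t] and u = [runs b 1 v]. Block k of v is b^b; q is the even position of its
    last letter but one, so block q of u is b^b too. The last letter of that block sits at an even
    position of u, and decoding the suffix from there twice yields 1 1 followed by t past index
    k. *)
Lemma runs_long_block_alt_lt b t k :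
    1 < b -> odd b -> over 1 b t -> alt_lyndon (runs b 1 (runs 1 b t)) ->
  odd k -> t k = b -> alt_lt t (cons_word 1 (cons_word 1 (suffix_at k.+1 t))).
Proof.
move=> b1 ob ot L ok tk; have to := over_all_odd (isT : odd 1) ob ot.
have t0 := odd_positive to; set v := runs 1 b t in L.
have vo : all_odd v by apply: (over_all_odd (isT : odd 1) ob); apply: runs_over.
have v0 := odd_positive vo.
have b3 : 2 < b by case: b b1 ob {ot tk v L vo v0} => [|[|[]]].
set q := block_start t k + (b - 2).
have vq : v q = b by rewrite /v /q runs_odd // tk ltn_subrL /= ltnW // ltnW.
have oq : ~~ odd q by rewrite oddD odd_block_start // ok oddB ?ob // ltnW.
have op : ~~ odd (block_start v q + b.-1).
  by rewrite oddD odd_block_start // (negbTE oq) -subn1 oddB ?ob // ltnW.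
have lt : b.-1 < v q by rewrite vq prednK // ltnW.
have b1b : b - b.-1 = 1 by rewrite -subn1 subKn // ltnW.
have := L (block_start v q + b.-1)./2.
rewrite even_halfK // suffix_runs // (negbTE oq) vq b1b half_gt0.
have -> : 1 < block_start v q + b.-1.
  by rewrite (leq_trans _ (leq_addl _ _)) // ltn_predRL.
have -> : q.+1 = block_start t k + b.-1.
  by rewrite /q -addnS -subSn 1?ltnW // subSS subn1.
have ltt : b.-1 < t k by rewrite tk prednK // ltnW.
rewrite /v suffix_runs // ok tk b1b.
have st0 : positive (suffix_at k.+1 t) by move=> i; apply: t0.
rewrite cons_runs; last exact: positive_cons.
move=> /(_ isT) /(runs_lex_ltE b1 vo) H.
apply/(runs_alt_ltE b1 t0); first by do 2!apply: positive_cons => //.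
by apply: H; apply: over_all_odd (runs_over 1 b _).
Qed.

(* If [t 0 = 1], a letter b of t at an odd index is followed by a block 1 and
   again by b, so that t would end with (b 1)^omega. *)
Lemma alt_lyndon_runs_head_long b t :
    1 < b -> odd b -> smooth 1 b t -> alt_lyndon t ->
  alt_lyndon (runs b 1 (runs 1 b t)) -> t 0 = b.
Proof.
move=> b1 ob st Lt L; have ot := smooth_over st.
have b0 := ltnW b1.
case: (ot 0) => // t01; exfalso.
have [s ss [[_ Et]|[tb _]]] := smooth_runs (isT : 0 < 1) b0 st; last first.
  by rewrite tb in t01; rewrite t01 in b1.
have so := over_all_odd (isT : odd 1) ob (smooth_over ss); have s0 := odd_positive so.
have t0 := odd_positive (over_all_odd (isT : odd 1) ob ot).
have t_even k : ~~ odd k -> t k = 1.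
  move=> /(alt_lyndon_even_max Lt); rewrite t01 => le.
  by apply/eqP; rewrite eqn_leq le t0.
(* At even indices both words carry 1, so they first differ at an odd index, where the alternating
   order is the usual one. *)
have C k : odd k -> t k = b ->
    exists2 n, agree n t (cons_word 1 (cons_word 1 (suffix_at k.+1 t)))
             & odd n /\ t n < cons_word 1 (cons_word 1 (suffix_at k.+1 t)) n.
  move=> ok tk; have [n agr] := runs_long_block_alt_lt b1 ob ot L ok tk.
  case E: (odd n); first by exists n.
  rewrite t_even ?E //; case: n E {agr} => [|[|n]] //=.
  by rewrite negbK => E; rewrite /suffix_at t_even // oddD /= ok E.
(* Otherwise t starts with 1 b, which cannot be below a word starting with 1 1. *)
have s0b : s 0 = b.
  case: (smooth_over ss 0) => // s01; exfalso.
  have t1 : t 1 = b by rewrite Et -s01 runs_second.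
  have [[|[|n]] agr [//= _]] := C 1 isT t1; first by rewrite t1 ltnNge b0.
  by have := agr 1 isT; rewrite t1 /= => eb; rewrite eb in b1.
have tb : t b = b by rewrite Et -{2}s0b runs_second.
(* If t had 1 at index k+2, a whole block 1^b would start at k+1; the comparison word would then
   start with 1^(b+2), while t has b at index b. *)
have next k : odd k -> t k = b -> t k.+2 = b.
  move=> ok tk; case: (ot k.+2) => // tk2; exfalso.
  have run1 i : i < b -> t (k.+1 + i) = 1.
    have tk1 : t k.+1 = 1 by rewrite t_even //= ok.
    have [l [j lt Ek]] := block_decomposition k.+1 s0.
    have El : ~~ odd l.
      by apply/negP => ol; move: tk1; rewrite Et Ek runs_odd // => eb; rewrite eb in b1.
    have j0 : j = 0.
      case: j lt Ek => // j lt; rewrite addnS => -[Ek].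
      by move: tk; rewrite Et Ek runs_even // ?(ltnW lt) // => eb; rewrite -eb in b1.
    rewrite j0 addn0 in Ek.
    have slb : s l = b.
      case: (smooth_over ss l) => // sl1.
      have : t k.+2 = b.
        have -> : k.+2 = block_start s l.+1 + 0 by rewrite addn0 block_startS -Ek sl1 addn1.
        by rewrite Et runs_odd.
      by rewrite tk2 => eb; rewrite -eb in b1.
    by move=> lti; rewrite Et Ek runs_even // slb.
  have [n agr [on]] := C k ok tk.
  have [lt_nb|lt_bn|->] := ltngtP n b.
  - case: n on lt_nb {agr} => [|[|n]] //= _ lt_nb; first by rewrite ltnNge t0.
    by rewrite /suffix_at (run1 _ (ltnW (ltnW lt_nb))) ltnNge t0.
  - have := agr b lt_bn; case: (b) b1 tb run1 => [|[|b']] // _ -> run1 /=.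
    by rewrite /suffix_at run1 // ltnW.
  - case: (b) b1 tb run1 => [|[|b']] // _ -> run1 /=.
    by rewrite /suffix_at run1 // ltnW.
have t_odd k : odd k -> b <= k -> t k = b.
  move=> ok le; rewrite -(subnKC le).
  have /even_halfK <- : ~~ odd (k - b) by rewrite oddB // ok ob.
  elim: (k - b)./2 => [|i IH]; first by rewrite addn0.
  by rewrite doubleS !addnS next // oddD odd_double ob.
have ne1b : 1 <> b by move=> eb; rewrite -eb in b1.
have [x _ Dx] := smooth_Delta ss.
(* From index b on t alternates b and 1, so s is eventually 1 and has no derivative. *)
apply: (Delta_not_eventually_constant Dx (n := b) (c := 1)).
apply: (@runs_unit_blocks 1 b) => // i le; rewrite -Et.
case E: (odd i); last by rewrite t_even ?E // t_odd //= ?E // ltnW.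
by rewrite t_odd // t_even /= ?E // => /esym.
Qed.

(** * Classification of the smooth Lyndon words *)

Lemma smooth_lyndon_runs a b w : 0 < a -> a < b ->
    smooth a b w -> infinite_lyndon w ->
  exists2 u, smooth a b u & w = runs a b u.
Proof.
move=> a0 ab sw L; have b0 := ltn_trans a0 ab.
have [u su [[_ ->]|[wb E]]] := smooth_runs a0 b0 sw; first by exists u.
have u0 : positive u by move=> k; case: (smooth_over su k) => ->.
have /lex_lt_head := L _ (u0 0); rewrite /suffix_at addn0 E runs_second // -E wb.
by rewrite leqNgt ab.
Qed.

(* The Lyndon words starting with 1^b. *)
Definition long_lyndon (b : nat) (w : word) : Prop :=
  exists u, [/\ smooth 1 b u, alt_lyndon u, u 0 = b & w = runs 1 b u].

(** Descend two levels: u = [runs b 1 v] with [v 0 = 1], so v = [runs 1 b t], where t is again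
    alternating Lyndon and starts with b. *)
Lemma alt_lyndon_head_max a b u : 0 < a -> a < b -> odd a -> odd b ->
    smooth a b u -> alt_lyndon u -> u 0 = b ->
  a = 1 /\ exists2 v, long_lyndon b v & u = runs b 1 v.
Proof.
move=> a0 ab oa ob su L u0b; have b0 := ltn_trans a0 ab.
have [v sv [[u0a _]|[_ E]]] := smooth_runs a0 b0 su.
  by move: ab; rewrite -u0a u0b ltnn.
have ov := smooth_over sv.
have vo : all_odd v := over_all_odd oa ob ov.
rewrite E in L; have [a1 v01 ev] := alt_lyndon_runs_head ab oa ob ov L.
subst a; split=> //; exists v => //.
have [t st [[_ Ev]|[vb _]]] := smooth_runs (isT : 0 < 1) b0 sv; last first.
  by move: ab; rewrite -vb v01.
have to := over_all_odd oa ob (smooth_over st).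
rewrite Ev in ev L; have Lt := even_lyndon_runs ab to ev.
by exists t; split=> //; apply: alt_lyndon_runs_head_long L.
Qed.

(** When all even-indexed letters are 1, u and an even suffix of it first differ at an odd index,
    where both orders coincide. The converse below holds for the same reason. *)
Lemma alt_lyndon_even_one u :
    alt_lyndon u -> (forall k, ~~ odd k -> u k = 1) -> even_lyndon u.
Proof.
move=> L u1 j j0; have [n agr] := L j j0; case E: (odd n); first by exists n.
by rewrite u1 ?E // /suffix_at u1 // oddD odd_double E.
Qed.

Lemma even_lyndon_even_one u :
    even_lyndon u -> (forall k, ~~ odd k -> u k = 1) -> alt_lyndon u.
Proof.
move=> L u1 j j0; have [n agr lt] := L j j0; exists n => //.
by case: ifP => // E; move: lt; rewrite u1 ?E // /suffix_at u1 // oddD odd_double E.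
Qed.

Lemma alt_lyndon_head_min a b u : 0 < a -> a < b -> odd a -> odd b ->
    smooth a b u -> alt_lyndon u -> u 0 = a ->
  a = 1 /\ long_lyndon b u.
Proof.
move=> a0 ab oa ob su L u0a; have b0 := ltn_trans a0 ab.
have neab : a <> b by move=> e; rewrite e ltnn in ab.
have [v sv [[_ E]|[u0b _]]] := smooth_runs a0 b0 su; last by rewrite u0a in u0b.
have ou := smooth_over su; have ov := smooth_over sv.
have vo : all_odd v := over_all_odd oa ob ov.
have v0 := odd_positive vo.
have u_even k : ~~ odd k -> u k = a.
  move=> /(alt_lyndon_even_max L); rewrite u0a => le.
  by case: (ou k) => // ub; move: le; rewrite ub leqNgt ab.
(* Such a block of b starts at an odd position, so a second letter would put b at an even position
   of u. *)
have v_odd k : odd k -> v k = 1.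
  move=> ok; apply/eqP; rewrite eqn_leq v0 andbT leqNgt; apply/negP => lt.
  apply: neab; rewrite -(u_even (block_start v k + 1)) ?E ?runs_odd //.
  by rewrite oddD odd_block_start // ok.
have a1 : a = 1.
  by rewrite -(v_odd 1) //; case: (ov 1) => // vb; move: ab a0; rewrite -vb v_odd // ltnNge => /negP.
rewrite {}a1 in ab oa sv ov E u_even *; split=> //.
have eu := alt_lyndon_even_one L u_even.
rewrite E in eu; have Lv := even_lyndon_runs ab vo eu.
(* If [v 0 = 1], maximality at even indices makes v constantly 1, which leaves it without a
   derivative. *)
exists v; split=> //; case: (ov 0) => // v01; exfalso.
have [x _ Dx] := smooth_Delta sv.
apply: (Delta_not_eventually_constant Dx (n := 0) (c := 1)) => i _.
case E': (odd i); first exact: v_odd.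
apply/eqP; rewrite eqn_leq v0 andbT -v01 alt_lyndon_even_max ?E' //.
Qed.

Lemma long_lyndon_runs b w : 1 < b -> odd b -> long_lyndon b w ->
  exists2 v, long_lyndon b v & w = runs 1 b (runs b 1 v).
Proof.
move=> b1 ob [u [su L u0 ->]].
by have [_ [v ? ->]] := alt_lyndon_head_max (isT : 0 < 1) b1 (isT : odd 1) ob su L u0; exists v.
Qed.

(** Both words are images of words of the same kind under a contraction, so their common prefix can
    be lengthened indefinitely. Each round gains two letters; the induction uses one. *)
Lemma long_lyndon_unique b w w' : 1 < b -> odd b ->
  long_lyndon b w -> long_lyndon b w' -> w = w'.
Proof.
move=> b1 ob Lw Lw'.
suff agr n : forall w w', long_lyndon b w -> long_lyndon b w' -> agree n w w'.
  by apply: functional_extensionality => n; apply: (agr n.+1).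
elim: n => [|n IH] {Lw Lw'}w {}w' // Lw Lw'.
have [v Lv ->] := long_lyndon_runs b1 ob Lw.
have [v' Lv' ->] := long_lyndon_runs b1 ob Lw'.
have agr := blocks_agree (alternate 1 b)
  (blocks_agree (alternate b 1) (IH _ _ Lv Lv')).
by move=> i lt; apply: agr; apply: ltnW.
Qed.

Lemma smooth_lyndon_cases a b w : 0 < a -> a < b -> odd a -> odd b ->
    smooth a b w -> infinite_lyndon w ->
  a = 1 /\
  (long_lyndon b w \/ exists2 u, long_lyndon b u & w = runs 1 b u).
Proof.
move=> a0 ab oa ob sw L.
have [u su E] := smooth_lyndon_runs a0 ab sw L.
have uo := over_all_odd oa ob (smooth_over su).
have Lu : alt_lyndon u by apply: (even_lyndon_runs ab uo); rewrite -E; apply: lyndon_even.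
case: (smooth_over su 0) => u0.
  have [a1 lu] := alt_lyndon_head_min a0 ab oa ob su Lu u0.
  by split=> //; right; exists u; rewrite // E a1.
have [a1 _] := alt_lyndon_head_max a0 ab oa ob su Lu u0.
by rewrite a1 in su E; split=> //; left; exists u.
Qed.

(** * Existence and properties of the fixed point *)

Lemma contraction_fixpoint (F : word -> word) :
    (forall n u v, agree n u v -> agree n.+1 (F u) (F v)) ->
  exists m, m = F m.
Proof.
move=> contr; pose x n := iter n F (fun=> 0).
have xD n k : agree n (x n) (x (n + k)).
  by elim: n => [|n IH] //; rewrite addSn; apply: contr.
(* Letter i is stable from iterate i+1 on, so the limit word is read off this diagonal. *)
exists (fun i => x i.+1 i); apply: functional_extensionality => i.
apply: (contr i) => // j lt; rewrite (xD j.+1 (i - j.+1)) // subnKC //.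
Qed.

Section FixedPoint.

Variables (b : nat) (m : word).
Hypotheses (b1 : 1 < b) (ob : odd b) (mE : m = runs 1 b (runs b 1 m)).

Let u := runs b 1 m.

Let mu : m = runs 1 b u. Proof. exact: mE. Qed.
Let om : over 1 b m. Proof. by rewrite mu; apply: runs_over. Qed.
Let ou : over 1 b u. Proof. exact/overC/runs_over. Qed.
Let mo : all_odd m. Proof. exact: (over_all_odd (isT : odd 1) ob). Qed.
Let uo : all_odd u. Proof. exact: (over_all_odd (isT : odd 1) ob). Qed.
Let m0 : positive m. Proof. exact: odd_positive. Qed.
Let u0 : positive u. Proof. exact: odd_positive. Qed.
Let b0 : 0 < b. Proof. exact: ltnW. Qed.
Let ne1b : 1 <> b. Proof. by move=> e; move: b1; rewrite -e. Qed.

Lemma fixpoint_runs_head : u 0 = b.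
Proof. by rewrite /u /runs blocks_head. Qed.

(** A letter b at an even position k would lie in an odd block l < k of length [u l]. By induction
    the even-indexed blocks of m before k have length 1, which forces [u l = 1]; then k is the start
    of an odd block, hence odd. *)
Lemma fixpoint_even_one k : ~~ odd k -> m k = 1.
Proof.
elim/ltn_ind: k => k IH Ek; rewrite mu.
have [l [j lt [Ekl lk]]] := block_decomposition_le k u0.
case ol: (odd l); last by rewrite Ekl runs_even ?ol.
have lt_lk : l < k by rewrite ltn_neqAle lk andbT; apply: contraNneq Ek => <-.
have ul : u l = 1.
  have [i [r ltr [El il]]] := block_decomposition_le l m0.
  case oi: (odd i); first by rewrite /u El runs_odd.
  exfalso; move: ltr; rewrite IH ?oi ?(leq_ltn_trans il) // ltnS leqn0 => /eqP r0.
  by move: ol; rewrite El r0 addn0 odd_block_start // oi.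
move: lt; rewrite ul ltnS leqn0 => /eqP j0.
by move: Ek; rewrite Ekl j0 addn0 odd_block_start // ol.
Qed.

(** Induction on the even position k. Strictly inside a block of 1, the truncated block is shorter
    than [u 0 = b]. At a block start, pass to position l of u: either [u l = 1] settles the
    comparison, or l starts an even block i of m with i < k. *)
Lemma fixpoint_even_lyndon : even_lyndon m.
Proof.
suff H k : 0 < k -> ~~ odd k -> lex_lt m (suffix_at k m).
  by move=> j j0; apply: H; rewrite ?double_gt0 ?odd_double.
elim/ltn_ind: k => k IH k0 Ek.
have [l [r lt [Ekl lk]]] := block_decomposition_le k u0.
have El : ~~ odd l.
  apply/negP => ol; apply: ne1b.
  by rewrite -(fixpoint_even_one Ek) mu Ekl runs_odd.
have um n : alt_lt u (suffix_at n u) -> lex_lt (runs 1 b u) (runs 1 b (suffix_at n u)).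
  by apply: runs_alt_lt => // i; apply: u0.
rewrite Ekl mu; case: r lt Ekl => [|r] lt Ekl.
  rewrite addn0 suffix_runs0 // (negbTE El); apply: um.
  have l0 : 0 < l by case: l Ekl {lk El lt} => // e; rewrite e block_start0 in k0.
  (* The first block has length b > 1 and every other block is nonempty. *)
  have lt_lk : l < k.
    rewrite Ekl addn0; case: l l0 {lk El lt Ekl} => // l _; rewrite /block_start big_ord_recl.
    rewrite fixpoint_runs_head -addn1 addnC; apply: leq_add b1 _.
    by rewrite -{1}[l]card_ord -sum1_card; apply: leq_sum => i _; apply: u0.
  have [i [s lts [Eli il]]] := block_decomposition_le l m0.
  case oi: (odd i).
    by exists 0; rewrite //= fixpoint_runs_head /suffix_at addn0 /u Eli runs_odd.
  have s0 : s = 0 by move: lts; rewrite fixpoint_even_one ?oi //; case: (s).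
  rewrite s0 addn0 in Eli; rewrite Eli suffix_runs0 // oi.
  apply: runs_lex_lt => //; first exact: all_odd_suffix.
  apply: IH; rewrite ?oi ?(leq_ltn_trans il) //.
  by case: i Eli {il oi lts} => //; rewrite block_start0 => e; rewrite e in l0.
rewrite suffix_runs // (negbTE El); apply: runs_alt_lt => //.
  by apply: positive_cons; rewrite ?subn_gt0 // => i; apply: u0.
exists 0 => //=; rewrite fixpoint_runs_head.
case: (ou l) lt => -> // lt; rewrite ltn_subrL //.
Qed.

Lemma fixpoint_alt_lyndon : alt_lyndon u.
Proof. by apply: (even_lyndon_runs b1 uo); rewrite -mu; apply: fixpoint_even_lyndon. Qed.

Lemma Delta_fixpoint : Delta m u.
Proof.
split=> //; exists (alternate 1 b); last by rewrite {1}mu.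
by move=> k; rewrite /alternate /=; case: (odd k) => // /esym.
Qed.

Lemma Delta_fixpoint_runs : Delta u m.
Proof.
split=> //; exists (alternate b 1) => // k.
by rewrite /alternate /=; case: (odd k) => // /esym.
Qed.

(** The words m and u form a 2-cycle under [Delta]. *)
Lemma smooth_fixpoint_both w : w = m \/ w = u -> smooth 1 b w.
Proof.
apply: (smooth_coind (P := fun w => w = m \/ w = u)) => {}w [] ->; split=> //.
  by exists u; [right | apply: Delta_fixpoint].
by exists m; [left | apply: Delta_fixpoint_runs].
Qed.

Lemma smooth_fixpoint : smooth 1 b m.
Proof. by apply: smooth_fixpoint_both; left. Qed.

Lemma long_lyndon_fixpoint : long_lyndon b m.
Proof.
exists u; split; [|exact: fixpoint_alt_lyndon|exact: fixpoint_runs_head|exact: mu].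
by apply: smooth_fixpoint_both; right.
Qed.

Lemma smooth_runs_fixpoint : smooth 1 b (runs 1 b m).
Proof.
apply: (smooth_coind (P := fun w => [\/ w = runs 1 b m, w = m | w = u])); last by constructor.
move=> w [] ->; split=> //; first exact: runs_over.
- exists m; first by constructor.
  split=> //; exists (alternate 1 b) => // k.
  by rewrite /alternate /=; case: (odd k) => // /esym.
- by exists u; [constructor | apply: Delta_fixpoint].
- by exists m; [constructor | apply: Delta_fixpoint_runs].
Qed.

Lemma fixpoint_lyndon : infinite_lyndon m.
Proof. by rewrite mu; apply: alt_lyndon_runs => //; apply: fixpoint_alt_lyndon. Qed.

Lemma runs_fixpoint_lyndon : infinite_lyndon (runs 1 b m).
Proof.
apply: alt_lyndon_runs => //; apply: even_lyndon_even_one fixpoint_even_one.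
exact: fixpoint_even_lyndon.
Qed.

Lemma fixpoint_one i : i < b -> m i = 1.
Proof. by move=> lt; rewrite mu /runs blocks_first ?fixpoint_runs_head. Qed.

(** Induction on the first difference n. As m starts with 1^b, so n > 1, w starts with 1 1 and is
    decoded from some v' as [runs 1 b (runs b 1 v')]. If v' is above m, so is w by monotonicity; if
    v' is below m, it differs from m earlier than w does. *)
Lemma fixpoint_minimal w : smooth 1 b w -> ~ lex_lt w m.
Proof.
move=> sw [n]; elim/ltn_ind: n w sw => n IH w sw agr lt.
have [wn mn] : w n = 1 /\ m n = b.
  by move: lt; case: (smooth_over sw n) (om n) => -> [] ->; rewrite ?ltnn // ltnNge b0.
have m_one i : i < b -> i <> n.
  by move=> /fixpoint_one mi e; apply: ne1b; rewrite -mn -e.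
have n1 : 1 < n.
  by case: n mn m_one {IH agr lt wn} => [|[|n]] // _ H; [case: (H 0 b0) | case: (H 1 b1)].
have [u' su' [[w0 Ew]|[w0 _]]] := smooth_runs (isT : 0 < 1) b0 sw; last first.
  by apply: ne1b; rewrite -w0 agr 1?ltnW // fixpoint_one.
have u'o := over_all_odd (isT : odd 1) ob (smooth_over su').
have u'0 := odd_positive u'o.
have [v' sv' [[u'01 _]|[_ Eu']]] := smooth_runs (isT : 0 < 1) b0 su'.
  apply: ne1b; rewrite -(fixpoint_one b1) -agr // Ew -{2}u'01.
  by rewrite runs_second.
have v'o := over_all_odd (isT : odd 1) ob (smooth_over sv').
case: (lex_lt_total v' m) => [Ev|[k agr' lt']|lt'].
- by apply: ne1b; rewrite -mn -wn Ew Eu' Ev -mE.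
(* If n <= k, the common prefix of v' and m would already force w and m to agree at n. *)
- apply: (IH k _ v' sv' agr' lt'); rewrite ltnNge; apply/negP => le.
  have /(_ n) := blocks_agree (alternate 1 b) (blocks_agree (alternate b 1) agr').
  rewrite -/(runs b 1 v') -/(runs b 1 m) -/(runs 1 b _) -/(runs 1 b _).
  rewrite -Eu' -Ew -mE wn mn => /(_ _) ne; apply/ne1b/ne.
  by rewrite !ltnS (leq_trans le).
- apply: (@lex_lt_asym w m); first by exists n.
  rewrite Ew mu; apply: runs_alt_lt => //; rewrite Eu'.
  exact: runs_lex_lt.
Qed.

Lemma min_smooth_fixpoint : min_smooth 1 b m.
Proof.
split=> [|w sw]; first exact: smooth_fixpoint.
by case: (lex_lt_total m w) => [->|lt|/(fixpoint_minimal sw)//]; [left|right].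
Qed.

(** At index 1, m still has 1, whereas [m 0 = 1] makes [runs 1 b m] switch to b. *)
Lemma fixpoint_neq_runs : ~ m =1 runs 1 b m.
Proof.
move=> /(_ 1); rewrite fixpoint_one //.
by have := runs_second 1 b m0; rewrite fixpoint_one // => ->.
Qed.

End FixedPoint.

Lemma exists_fixpoint b : exists m, m = runs 1 b (runs b 1 m).
Proof.
apply: contraction_fixpoint => n u v agr i lt.
by apply: (blocks_agree _ (blocks_agree _ agr)); apply: ltnW.
Qed.

Theorem theorem20 (a b : nat) (ha : 0 < a) (hab : a < b)
    (oa : odd a) (ob : odd b) :
  ((exists w : word, smooth a b w /\ infinite_lyndon w) <-> a = 1) /\
  (a = 1 ->
   exists m : word,
     min_smooth 1 b m /\
     ~ (m =1 Delta_inv 1 b 1 m) /\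
     (forall w : word,
        (smooth 1 b w /\ infinite_lyndon w) <->
        (w =1 m \/ w =1 Delta_inv 1 b 1 m))).
Proof.
have [m mE] := exists_fixpoint b.
split; first split.
- by move=> [w [sw L]]; have [] := smooth_lyndon_cases ha hab oa ob sw L.
- move=> a1; subst a; exists m; split; first exact: (smooth_fixpoint hab ob mE).
  exact: (fixpoint_lyndon hab ob mE).
move=> a1; subst a; have -> : Delta_inv 1 b 1 = runs 1 b by [].
exists m; split; first exact: (min_smooth_fixpoint hab ob mE).
split; first exact: (fixpoint_neq_runs hab ob mE).
have Lm := long_lyndon_fixpoint hab ob mE.
move=> w; split=> [[sw L]|].
  (* The word w, or else its derivative, is of the unique kind starting with 1^b, hence equals m. *)
  have [_ [Lw|[u Lu ->]]] := smooth_lyndon_cases ha hab oa ob sw L.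
    by left=> i; rewrite (long_lyndon_unique hab ob Lw Lm).
  by right; rewrite (long_lyndon_unique hab ob Lu Lm).
case=> /functional_extensionality ->; split.
- exact: (smooth_fixpoint hab ob mE).
- exact: (fixpoint_lyndon hab ob mE).
- exact: (smooth_runs_fixpoint hab ob mE).
- exact: (runs_fixpoint_lyndon hab ob mE).
Qed.
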